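(* Let $n,p\ge 1$, let $X\in\mathbb{R}^{n\times p}$ be a deterministic matrix with columns $X^{(1)},\dots,X^{(p)}$ normalized so that $(X^TX)_{jj}=n$ for all $1\le j\le p$, let $\beta_0\in\mathbb{R}^p$, $\sigma>0$, and let $Y=X\beta_0+\sigma\epsilon$ where $\epsilon$ is a standard normal random vector in $\mathbb{R}^n$ (mean zero, identity covariance). Let $\kappa\in(0,1]$, let $K_\kappa$ be the correlation factor of $X$ defined in the context, and let $$\lambda\ \ge\ \lambda_\kappa:=K_\kappa\,2\sigma\sqrt{2n\log(2p/\kappa)}.$$ Let $\hat\beta$ be a Lasso estimator with tuning parameter $\lambda$, i.e. $$\hat\beta\in\operatorname*{arg\,min}_{\beta\in\mathbb{R}^p}\left\{\|Y-X\beta\|_2^2+\lambda\|\beta\|_1\right\}.$$ Then, with probability at least $1-\kappa$, $$\|X(\hat\beta-\beta_0)\|_2^2\ \le\ 2\lambda\|\beta_0\|_1 .$$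
   Context: Notation: $S^{n-1}$ is the Euclidean unit sphere of $\mathbb{R}^n$, so $\sqrt n S^{n-1}$ is the sphere of radius $\sqrt n$. For vectors $x^{(1)},\dots,x^{(l)}\in\mathbb{R}^n$, $\operatorname{sconv}\{x^{(1)},\dots,x^{(l)}\}$ denotes their symmetric convex hull, i.e. the set of all $\sum_{j=1}^l c_jx^{(j)}$ with $c_j\in\mathbb{R}$ and $\sum_{j=1}^l|c_j|\le 1$. Correlation function of $X$: for $x\in[0,\infty)$, $$K(x):=\min\Big\{l\in\{1,2,\dots\}:\ \exists\, x^{(1)},\dots,x^{(l)}\in\sqrt n S^{n-1}\ \text{such that}\ X^{(m)}\in(1+x)\operatorname{sconv}\{x^{(1)},\dots,x^{(l)}\}\ \text{for all } 1\le m\le p\Big\}.$$ Correlation factor of $X$: for $\kappa\in(0,1]$, $$K_\kappa:=\inf_{x\in[0,\infty)}(1+x)\sqrt{\frac{\log(2K(x)/\kappa)}{\log(2p/\kappa)}}.$$ The estimator $\hat\beta$ is any (measurable) choice of minimizer of the Lasso criterion. ''With probability at least $1-\kappa$'' refers to the distribution of $\epsilon$. *)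

(* Defs.v *)
From HB Require Import structures.
From mathcomp Require Import all_boot all_order all_algebra.
From mathcomp Require Import all_classical all_reals all_analysis.

Set Implicit Arguments.
Unset Strict Implicit.
Unset Printing Implicit Defensive.

Import Order.TTheory GRing.Theory Num.Theory.
Import numFieldNormedType.Exports.

Local Open Scope classical_set_scope.
Local Open Scope ring_scope.

(* The norm `|v| that MathComp-Analysis puts on 'cV[R]_n is the sup norm, hence
   the explicit l1 and l2 norms. *)
Definition norm1 (R : realType) (n : nat) (v : 'cV[R]_n) : R :=
  \sum_(i < n) `|v i 0|.

Definition norm2 (R : realType) (n : nat) (v : 'cV[R]_n) : R :=
  Num.sqrt (\sum_(i < n) v i 0 ^+ 2).

Definition sphere2 (R : realType) (n : nat) (r : R) : set 'cV[R]_n :=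
  [set v | norm2 v = r].

Definition sconv (R : realType) (n l : nat) (xs : 'I_l -> 'cV[R]_n) :
    set 'cV[R]_n :=
  [set v | exists2 c : 'I_l -> R,
     \sum_(j < l) `|c j| <= 1 & v = \sum_(j < l) c j *: xs j].

Definition corr_admissible (R : realType) (n p : nat) (X : 'M[R]_(n, p)) (x : R)
    (l : nat) : Prop :=
  (1 <= l)%N /\
  exists2 xs : 'I_l -> 'cV[R]_n,
    (forall j, sphere2 (Num.sqrt n%:R) (xs j)) &
    forall m : 'I_p, [set (1 + x) *: u | u in sconv xs] (col m X).

(* The default value 0 of xget is never reached for a design with normalized
   columns: see corr_funP. *)
Definition corr_fun (R : realType) (n p : nat) (X : 'M[R]_(n, p)) (x : R) : nat :=
  xget 0%N [set l | corr_admissible X x l /\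
                    forall l', corr_admissible X x l' -> (l <= l')%N].

Lemma corr_funP (R : realType) (n p : nat) (X : 'M[R]_(n, p)) (x : R) :
  (0 < p)%N -> (forall j, (X^T *m X) j j = n%:R) -> 0 <= x ->
  corr_admissible X x (corr_fun X x) /\
  forall l, corr_admissible X x l -> (corr_fun X x <= l)%N.
Proof.
move=> p_gt0 XX x_ge0; have x1_gt0 : 0 < 1 + x by rewrite ltr_pwDl.
have adm : exists l, `[< corr_admissible X x l >].
  exists p; apply/asboolP; split => //; exists (fun j => col j X) => [j|m].
    rewrite /sphere2 /= /norm2 -(XX j) mxE; congr Num.sqrt.
    by apply: eq_bigr => i _; rewrite !mxE expr2.
  exists ((1 + x)^-1 *: col m X); last by rewrite scalerA divff ?gt_eqF ?scale1r.
  exists (fun j => if j == m then (1 + x)^-1 else 0).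
    rewrite (bigD1 m) //= eqxx big1 ?addr0; last first.
      by move=> j /negbTE ->; rewrite normr0.
    have x1V_ge0 : 0 <= (1 + x)^-1 by rewrite invr_ge0 ltW.
    by rewrite (ger0_norm x1V_ge0) invf_le1 // lerDl.
  rewrite (bigD1 m) //= eqxx big1 ?addr0 // => j /negbTE ->.
  by rewrite scale0r.
have [l /asboolP ladm lmin] := ex_minnP adm.
rewrite /corr_fun; case: xgetP => [k _ []//|/(_ l) []].
by split=> // l' l'adm; apply: lmin; apply/asboolP.
Qed.

Definition corr_factor (R : realType) (n p : nat) (X : 'M[R]_(n, p)) (kappa : R) :
    R :=
  inf [set (1 + x) * Num.sqrt (ln (2 * (corr_fun X x)%:R / kappa) /
                               ln (2 * p%:R / kappa))
      | x in [set x : R | 0 <= x]].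

Definition random_vector d (Omega : measurableType d) (R : realType) (n : nat)
    (V : Omega -> 'cV[R]_n) : Prop :=
  forall i, measurable_fun setT (fun w => V w i 0).

Definition mutually_independent d (Omega : measurableType d) (R : realType)
    (P : probability Omega R) (n : nat) (Z : 'I_n -> Omega -> R) : Prop :=
  forall (J : {set 'I_n}) (A : 'I_n -> set R), (forall i, measurable (A i)) ->
    P [set w | forall i, i \in J -> A i (Z i w)] =
    (\prod_(i in J) P (Z i @^-1` A i))%E.

(* N(0, I_n): the coordinates are independent N(0, 1) variables. *)
Definition standard_normal_vector d (Omega : measurableType d) (R : realType)
    (P : probability Omega R) (n : nat) (eps : Omega -> 'cV[R]_n) : Prop :=
  [/\ random_vector eps,
      (forall (i : 'I_n) (A : set R), measurable A ->
         P ((fun w => eps w i 0) @^-1` A) = normal_prob 0 1 A)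
    & mutually_independent P (fun i w => eps w i 0)].

Definition lasso_criterion (R : realType) (n p : nat) (X : 'M[R]_(n, p))
    (Y : 'cV[R]_n) (lambda : R) (beta : 'cV[R]_p) : R :=
  norm2 (Y - X *m beta) ^+ 2 + lambda * norm1 beta.

Definition lasso (R : realType) (n p : nat) (X : 'M[R]_(n, p)) (Y : 'cV[R]_n)
    (lambda : R) : set 'cV[R]_p :=
  [set beta | forall beta',
     lasso_criterion X Y lambda beta <= lasso_criterion X Y lambda beta'].

(* Main.v *)
Require Import Defs.
From HB Require Import structures.
From mathcomp Require Import all_boot all_order all_algebra.
From mathcomp Require Import all_classical all_reals all_analysis.
From mathcomp Require Import measurable_realfun ring lra.

(* On the event that 2 sigma |<X_m, eps>| <= lambda for every column X_m,
   comparing the criterion at betahat and at beta0 gives the prediction bound.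
   If the columns lie in (1 + x) sconv {x_1, ..., x_l}, then max_m |<X_m, eps>|
   is at most (1 + x) max_j |<x_j, eps>|, so a Gaussian tail estimate and a union
   bound over l = K(x) points, instead of p columns, control the noise.  The
   infimum in the correlation factor need not be attained; the event for lambda
   is therefore treated as the decreasing intersection of the events for
   lambda + 1/(k+1). *)

Set Implicit Arguments.
Unset Strict Implicit.
Unset Printing Implicit Defensive.

Import Order.TTheory GRing.Theory Num.Theory.
Import numFieldNormedType.Exports.

Local Open Scope classical_set_scope.
Local Open Scope ring_scope.

(** * Integration against a measure given by a density along a map *)

Section density.
Import HBNNSimple.

(** The hypothesis on [nu] is the case of indicators; linearity gives simple functions, and monotone
    convergence along [nnsfun_approx] gives every nonnegative measurable [f]. Allowing both a map
    and a density covers laws of random variables ([phi] a coordinate) and the normal density ([phi]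
    the identity). *)
Lemma ge0_integral_density d d' (T : measurableType d) (T' : measurableType d')
    (R : realType) (mu : {measure set T -> \bar R})
    (nu : {measure set T' -> \bar R}) (phi : T -> T') (g : T -> R)
    (f : T' -> \bar R) :
  measurable_fun [set: T] phi ->
  measurable_fun [set: T] g -> (forall x, 0 <= g x) ->
  (forall A, measurable A -> nu A = (\int[mu]_(x in phi @^-1` A) (g x)%:E)%E) ->
  measurable_fun [set: T'] f -> (forall y, 0 <= f y)%E ->
  (\int[nu]_y f y = \int[mu]_x (f (phi x) * (g x)%:E))%E.
Proof.
move=> mphi mg g0 nuE mf f0.
pose h := nnsfun_approx measurableT mf.
have mhphi n : measurable_fun setT (h n \o phi) by exact: measurableT_comp.
have hphi_ge0 n x : 0 <= (h n (phi x) * g x) by rewrite mulr_ge0.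
have h_nd a b y : (a <= b)%N -> h a y <= h b y.
  by move=> ab; exact/lefP/nd_nnsfun_approx.
transitivity (limn (fun n => \int[nu]_y (h n y)%:E)%E).
  rewrite -monotone_convergence//=.
  - apply: eq_integral => y _; apply/esym/cvg_lim => //.
    exact: (@cvg_nnsfun_approx _ _ _ _ measurableT _ mf).
  - by move=> n; exact/measurable_EFinP.
  - by move=> n y _; rewrite lee_fin.
  - by move=> y _ a b ab; rewrite lee_fin h_nd.
transitivity (limn (fun n => \int[mu]_x (h n (phi x) * g x)%:E)%E); last first.
  rewrite -monotone_convergence//=.
  - apply: eq_integral => x _; apply/cvg_lim => //.
    under eq_fun do rewrite EFinM.
    apply: cvgeZr => //.
    exact: (@cvg_nnsfun_approx _ _ _ _ measurableT _ mf).
  - move=> n; apply/measurable_EFinP.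
    by apply: measurable_funM; [exact: (mhphi n)|].
  - by move=> n x _; rewrite lee_fin.
  - by move=> x _ a b ab; rewrite lee_fin ler_wpM2r// h_nd.
congr (lim (_ @ \oo)); apply/funext => n.
(* For a simple function both sides are finite sums over its values, and on the level set [B] of
   each value the equality reduces to [nuE]. *)
rewrite integralT_nnsfun sintegralE.
under [RHS]eq_integral => x _.
  rewrite fimfunE EFinM -fsumEFin// ge0_mule_fsuml; last first.
    by move=> y; rewrite EFinM; exact: nnfun_muleindic_ge0.
  over.
rewrite ge0_integral_fsum//; last 2 first.
- move=> y; apply: emeasurable_funM; last exact/measurable_EFinP.
  apply/measurable_EFinP/measurable_funM => //.
  by apply: measurableT_comp => //; exact: measurable_indic.
- move=> y x _; rewrite mule_ge0 ?lee_fin// -lee_fin EFinM.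
  exact: nnfun_muleindic_ge0.
apply: eq_fsbigr => _ /set_mem[y _ <-].
set B := h n @^-1` [set h n y].
have mB : measurable B by exact: measurable_funPTI.
have mphiB : measurable (phi @^-1` B).
  by rewrite -[X in measurable X]setTI; exact: mphi.
under eq_integral => x _ do rewrite EFinM -muleA.
rewrite ge0_integralZl//; last 3 first.
- apply: emeasurable_funM; last exact/measurable_EFinP.
  by apply/measurable_EFinP/measurableT_comp => //; exact: measurable_indic.
- by move=> x _; rewrite mule_ge0 ?lee_fin.
- by rewrite lee_fin.
congr (_ * _)%E; rewrite nuE//.
rewrite [RHS](eq_integral ((fun x => (g x)%:E) \_ (phi @^-1` B))); last first.
  by move=> x _; rewrite epatch_indic muleC.
by rewrite -integral_mkcond.
Qed.

End density.

(** * Expectation of a product of functions of independent variables *)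

Lemma indep_integral_prod d (Omega : measurableType d) (R : realType)
    (P : probability Omega R) (n : nat) (Z : 'I_n -> Omega -> R)
    (F : 'I_n -> R -> R) :
  (forall i, measurable_fun [set: Omega] (Z i)) -> mutually_independent P Z ->
  (forall i, measurable_fun [set: R] (F i)) -> (forall i x, 0 <= F i x) ->
  (forall i, \int[P]_w (F i (Z i w))%:E < +oo)%E ->
  (\int[P]_w (\prod_i F i (Z i w))%:E = \prod_i \int[P]_w (F i (Z i w))%:E)%E.
Proof.
move=> mZ indZ.
(* Replace indicators by general functions one coordinate at a time: once the
   identity holds for indicators in coordinate k, it says that a multiple of the
   law of Z k has density g along Z k, where g is the product over i != k. *)
suff H m (G : 'I_n -> R -> R) : (forall i, measurable_fun [set: R] (G i)) ->
    (forall i x, 0 <= G i x) ->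
    (forall i, \int[P]_w (G i (Z i w))%:E < +oo)%E ->
    (forall i : 'I_n, (m <= i)%N -> exists2 A, measurable A & G i = \1_A) ->
    (\int[P]_w (\prod_i G i (Z i w))%:E = \prod_i \int[P]_w (G i (Z i w))%:E)%E.
  move=> mF F0 Foo; apply: (H n) => // i.
  by rewrite leqNgt ltn_ord.
elim: m G => [|m IH] G mG G0 Goo Gind.
  (* Base case: a product of indicators is the indicator of an intersection, so the identity is
     independence for the full index set. *)
  have /choice[A AP] : forall i : 'I_n, exists A, measurable A /\ G i = \1_A.
    by move=> i; have [//|A mA GA] := Gind i; exists A.
  have mZA i : measurable (Z i @^-1` A i).
    by rewrite -[X in measurable X]setTI; apply: mZ => //; exact: (AP i).1.
  have AE : [set w | forall i, i \in [set: 'I_n]%SET -> A i (Z i w)] =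
      \bigcap_(i in [set: 'I_n]) (Z i @^-1` A i).
    by apply/seteqP; split => w /= h i => [_|_]; apply: h; rewrite ?inE.
  transitivity (P [set w | forall i, i \in [set: 'I_n]%SET -> A i (Z i w)]).
    rewrite AE -[X in P X]setIT -integral_indic//; last first.
      exact: fin_bigcap_measurable.
    apply: eq_integral => w _; congr (_%:E).
    under eq_bigr => i _ do rewrite (AP i).2.
    rewrite indicE; case: (boolP (w \in _)) => /= [/set_mem Aw|/negP Aw].
      by rewrite big1// => i _; rewrite indicE mem_set//; exact: Aw.
    apply/eqP; rewrite prodf_seq_eq0; apply: contra_notT Aw.
    rewrite -all_predC => /allP Aw.
    apply: mem_set => i _ /=; have := Aw i (mem_index_enum _).
    by rewrite /= indicE; case: (boolP (_ \in _)) => [/set_mem//|]; rewrite eqxx.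
  rewrite indZ; last by move=> i; exact: (AP i).1.
  apply: eq_big => [i|i _]; first by rewrite inE.
  rewrite (AP i).2 -[X in P X]setIT -integral_indic//.
(* If [n <= m], no index is at least [m] and the induction hypothesis applies vacuously. Otherwise
   [k], of value [m], is the one coordinate newly allowed to be a general function. *)
have [nm|mn] := leqP n m.
  apply: IH => // i mi; have := leq_trans nm mi; by rewrite leqNgt ltn_ord.
pose k := Ordinal mn.
pose g w := \prod_(i < n | i != k) G i (Z i w).
(* Finiteness of the expectations makes [c] a real number. Scaling the law of [Z k] by [c], rather
   than dividing [g] by [c], also covers [c = 0]. *)
pose c := fine (\prod_(i < n | i != k) \int[P]_w (G i (Z i w))%:E)%E.
have c_ge0 : 0 <= c.
  rewrite fine_ge0// prode_ge0// => i _.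
  by apply: integral_ge0 => w _; rewrite lee_fin.
have cE : (c%:E = \prod_(i < n | i != k) \int[P]_w (G i (Z i w))%:E)%E.
  rewrite fineK//; apply: prode_fin_num => i _.
  by rewrite ge0_fin_numE// integral_ge0// => w _; rewrite lee_fin.
pose Zk_mixin := isMeasurableFun.Build _ _ _ _ _ (mZ k).
pose Zk : {mfun Omega >-> R} := HB.pack (Z k) Zk_mixin.
pose nu := mscale (NngNum c_ge0) (distribution P Zk).
have mGZ i : measurable_fun [set: Omega] (G i \o Z i) by exact: measurableT_comp.
have mg : measurable_fun [set: Omega] g.
  rewrite (_ : g = fun w =>
    \prod_(i <- [seq i <- index_enum 'I_n | i != k]) G i (Z i w)).
    by apply: measurable_prod => i _; exact: mGZ.
  by apply/funext => w; rewrite big_filter.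
have g_ge0 w : 0 <= g w by rewrite /g prodr_ge0.
have nuE B : measurable B -> nu B = (\int[P]_(w in Z k @^-1` B) (g w)%:E)%E.
  move=> mB.
  (* With the indicator of [B] in coordinate [k], all coordinates from [m] on are indicators, so the
     induction hypothesis computes [nu B]. *)
  pose G' (i : 'I_n) := if i == k then \1_B else G i.
  have G'k : G' k = \1_B by rewrite /G' eqxx.
  have G'E i : i != k -> G' i = G i by rewrite /G' => /negbTE ->.
  have mZB : measurable (Z k @^-1` B).
    by rewrite -[X in measurable X]setTI; exact: (mZ k measurableT).
  have G'P : (\int[P]_w (\1_B (Z k w))%:E = P (Z k @^-1` B))%E.
    by rewrite -[X in P X]setIT -integral_indic.
  have := IH G'.
  rewrite (bigD1 k)//= G'k G'P.
  under eq_bigr => i /G'E -> do [].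
  rewrite -cE.
  under eq_integral => w _.
    rewrite (bigD1 k)//= G'k EFinM muleC; under eq_bigr => i /G'E -> do [].
    rewrite -[X in (_ * X)%E]/((\1_(Z k @^-1` B) w)%:E); over.
  move=> H; rewrite /nu /mscale/= muleC -[LHS]H.
  - rewrite [RHS]integral_mkcond; apply: eq_integral => w _.
    by rewrite epatch_indic.
  - by move=> i; rewrite /G'; case: ifP => // _; exact: measurable_indic.
  - by move=> i x; rewrite /G'; case: ifP => // _; rewrite indicE.
  - move=> i; rewrite /G'; case: ifP => // /eqP ->; rewrite G'P.
    by rewrite (le_lt_trans (probability_le1 _ _))// ltry.
  - move=> i mi; rewrite /G'; have [_|ik] := eqVneq i k; first by exists B.
    apply: Gind; rewrite ltn_neqAle mi andbT; apply: contra_neq ik => ik.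
    exact/val_inj.
have := @ge0_integral_density _ _ _ _ _ P nu (Z k) g (EFin \o G k) (mZ k) mg
  g_ge0 nuE.
rewrite ge0_integral_mscale//; last 2 first.
- exact/measurable_EFinP.
- by move=> x _; rewrite lee_fin.
rewrite ge0_integral_distribution//; last 2 first.
- exact/measurable_EFinP.
- by move=> x; rewrite lee_fin.
move=> H; rewrite [RHS](bigD1 k)//= -cE muleC [RHS]H//; last 2 first.
- exact/measurable_EFinP.
- by move=> x; rewrite lee_fin.
by apply: eq_integral => w _; rewrite (bigD1 k).
Qed.

(** * Gaussian moment generating functions and tails *)

Lemma normal_mgf (R : realType) (nu : {measure set R -> \bar R}) (a : R) :
  (forall A, measurable A -> nu A = normal_prob 0 1 A) ->
  (\int[nu]_x (expR (a * x))%:E = (expR (a ^+ 2 / 2))%:E)%E.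
Proof.
move=> nuE.
have mexp : measurable_fun [set: R] (fun x => (expR (a * x))%:E).
  by apply/measurable_EFinP; apply: measurableT_comp => //;
    exact: measurable_funM.
rewrite (@ge0_integral_density _ _ _ _ _ lebesgue_measure nu id
  (normal_pdf 0 1))//; last 2 first.
- exact: measurable_normal_pdf.
- by move=> x; exact: normal_pdf_ge0.
(* Completing the square: exp(a x) times the N(0, 1) density is exp(a^2 / 2)
   times the N(a, 1) density. *)
transitivity (\int[lebesgue_measure]_x
    ((expR (a ^+ 2 / 2))%:E * (normal_pdf a 1 x)%:E))%E.
  apply: eq_integral => x _; rewrite -!EFinM; congr (_%:E).
  rewrite !normal_pdfE ?oner_neq0// mulrCA [RHS]mulrCA; congr (_ * _).
  rewrite /normal_fun -!expRD; congr expR.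
  by field.
rewrite ge0_integralZl//; first by rewrite integral_normal_pdf mule1.
  by apply/measurable_EFinP; exact: measurable_normal_pdf.
by move=> x _; rewrite lee_fin normal_pdf_ge0.
Qed.

Definition dotv (R : realType) (n : nat) (u v : 'cV[R]_n) : R :=
  \sum_(i < n) u i 0 * v i 0.

Lemma dotvv (R : realType) (n : nat) (u : 'cV[R]_n) : dotv u u = norm2 u ^+ 2.
Proof.
rewrite /norm2 sqr_sqrtr; first by apply: eq_bigr => i _; rewrite expr2.
by apply: sumr_ge0 => i _; exact: sqr_ge0.
Qed.

Lemma measurable_dotv d (Omega : measurableType d) (R : realType) (n : nat)
    (u : 'cV[R]_n) (V : Omega -> 'cV[R]_n) :
  random_vector V -> measurable_fun [set: Omega] (fun w => dotv u (V w)).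
Proof.
by move=> mV; apply: measurable_sum => i; apply: measurable_funM.
Qed.

(** The exponential of the linear form is a product of functions of the independent coordinates.
    Each factor contributes the [N(0, 1)] transform at [s * u i 0], and the exponents add up to the
    squared norm. *)
Lemma gauss_mgf d (Omega : measurableType d) (R : realType)
    (P : probability Omega R) (n : nat) (eps : Omega -> 'cV[R]_n) (u : 'cV[R]_n)
    (s : R) :
  standard_normal_vector P eps ->
  (\int[P]_w (expR (s * dotv u (eps w)))%:E =
   (expR (s ^+ 2 * norm2 u ^+ 2 / 2))%:E)%E.
Proof.
move=> [meps eps_law eps_indep].
pose F (i : 'I_n) (x : R) := expR (s * u i 0 * x).
have mF i : measurable_fun [set: R] (F i).
  by apply: measurableT_comp => //; exact: measurable_funM.
have FE i : (\int[P]_w (F i (eps w i 0))%:E = (expR ((s * u i 0) ^+ 2 / 2))%:E)%E.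
  pose X_mixin := isMeasurableFun.Build _ _ _ _ _ (meps i).
  pose X : {mfun Omega >-> R} := HB.pack (fun w => eps w i 0) X_mixin.
  transitivity (\int[distribution P X]_y (F i y)%:E)%E; last first.
    by apply: normal_mgf => A mA; rewrite -(eps_law i).
  rewrite (@ge0_integral_distribution _ _ _ _ _ P X (EFin \o F i))//;
    last 2 first.
    exact/measurable_EFinP.
  by move=> x; rewrite lee_fin expR_ge0.
transitivity (\int[P]_w (\prod_i F i (eps w i 0))%:E)%E.
  apply: eq_integral => w _; rewrite /F -expR_sum; congr (expR _)%:E.
  by rewrite mulr_sumr; apply: eq_bigr => i _; rewrite mulrA.
rewrite (@indep_integral_prod _ _ _ _ _ (fun i w => eps w i 0))//; last 2 first.
- by move=> i x; exact: expR_ge0.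
- by move=> i; rewrite FE ltry.
under eq_bigr do rewrite FE.
rewrite prodEFin -expR_sum; congr (expR _)%:E.
rewrite -dotvv mulr_sumr mulr_suml; apply: eq_bigr => i _.
by rewrite exprMn expr2.
Qed.

Lemma gauss_tail d (Omega : measurableType d) (R : realType)
    (P : probability Omega R) (n : nat) (eps : Omega -> 'cV[R]_n) (u : 'cV[R]_n)
    (t : R) :
  standard_normal_vector P eps -> 0 < norm2 u -> 0 < t ->
  (P [set w | t * norm2 u <= dotv u (eps w)]%R <= (expR (- (t ^+ 2 / 2)))%:E)%E.
Proof.
move=> eps_normal u_gt0 t_gt0.
have meps : random_vector eps by case: eps_normal.
pose X_mixin := isMeasurableFun.Build _ _ _ _ _ (measurable_dotv u meps).
pose X : {mfun Omega >-> R} := HB.pack (fun w => dotv u (eps w)) X_mixin.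
(* The parameter [s = t / norm2 u] minimizes the Chernoff exponent [s ^+ 2 * norm2 u ^+ 2 / 2 - s *
   t * norm2 u]; the minimum is [- (t ^+ 2 / 2)]. *)
apply: (le_trans (@chernoff _ _ _ P X (t / norm2 u) (t * norm2 u) _)).
  exact: divr_gt0.
rewrite /mmt_gen_fun expectation_def.
under eq_integral => w _ do rewrite /= mulrC.
rewrite (gauss_mgf _ _ eps_normal) -EFinM lee_fin -expRD ler_expR le_eqVlt.
apply/orP; left; apply/eqP; field; exact: lt0r_neq0.
Qed.

Lemma gauss_tail_abs d (Omega : measurableType d) (R : realType)
    (P : probability Omega R) (n : nat) (eps : Omega -> 'cV[R]_n) (u : 'cV[R]_n)
    (t : R) :
  standard_normal_vector P eps -> 0 < norm2 u -> 0 < t ->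
  (P [set w | t * norm2 u <= `|dotv u (eps w)|]%R <=
   (2 * expR (- (t ^+ 2 / 2)))%:E)%E.
Proof.
move=> eps_normal u_gt0 t_gt0.
have meps : random_vector eps by case: eps_normal.
have dotNv v : dotv (- u) v = - dotv u v.
  by rewrite /dotv -sumrN; apply: eq_bigr => i _; rewrite mxE mulNr.
have norm2N : norm2 (- u) = norm2 u.
  by congr Num.sqrt; apply: eq_bigr => i _; rewrite mxE sqrrN.
have mtail v : measurable [set w | t * norm2 u <= dotv v (eps w)].
  rewrite -[X in measurable X]setTI; apply: measurable_fun_le => //.
  exact: measurable_dotv.
rewrite (_ : [set w | _] = [set w | t * norm2 u <= dotv u (eps w)] `|`
                           [set w | t * norm2 u <= dotv (- u) (eps w)]).
  apply: (le_trans (measureU2 _ (mtail _) (mtail _))).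
  rewrite (_ : 2 * _ = expR (- (t ^+ 2 / 2)) + expR (- (t ^+ 2 / 2)));
    last by ring.
  rewrite EFinD leeD//; first exact: gauss_tail.
  by rewrite -norm2N; apply: gauss_tail; rewrite ?norm2N.
apply/seteqP; split=> w /=; rewrite dotNv ler_normr.
  by move=> /orP.
by move=> /orP.
Qed.

(** * Union bound for finitely many Gaussian linear forms *)

Lemma measure_bigsetU_le d (T : measurableType d) (R : realType)
    (mu : {measure set T -> \bar R}) (I : Type) (s : seq I) (F : I -> set T) :
  (forall i, measurable (F i)) ->
  (mu (\big[setU/set0]_(i <- s) F i) <= \sum_(i <- s) mu (F i))%E.
Proof.
move=> mF; elim: s => [|i s IH]; first by rewrite !big_nil measure0.
rewrite !big_cons (le_trans (measureU2 _ _ _))//; last by rewrite leeD2l.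
exact: bigsetU_measurable.
Qed.

Lemma measurable_dotv_abs_le d (Omega : measurableType d) (R : realType) (n : nat)
    (u : 'cV[R]_n) (V : Omega -> 'cV[R]_n) (c : R) :
  random_vector V -> measurable [set w | `|dotv u (V w)| <= c].
Proof.
move=> mV; rewrite -[X in measurable X]setTI; apply: measurable_fun_le => //.
by apply: measurableT_comp => //; exact: measurable_dotv.
Qed.

(** The threshold solves [2 * expR (- (t ^+ 2 / 2)) = kappa / l], so the [l] two-sided tails
    together cost at most [kappa]. *)
Lemma gauss_max_abs_le d (Omega : measurableType d) (R : realType)
    (P : probability Omega R) (n l : nat) (eps : Omega -> 'cV[R]_n)
    (xs : 'I_l -> 'cV[R]_n) (r kappa : R) :
  standard_normal_vector P eps -> 0 < r -> (forall j, norm2 (xs j) = r) ->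
  (1 <= l)%N -> 0 < kappa -> kappa <= 1 ->
  ((1 - kappa)%:E <=
   P [set w | forall j, `|dotv (xs j) (eps w)| <=
                        r * Num.sqrt (2 * ln (2 * l%:R / kappa))]%R)%E.
Proof.
move=> eps_normal r_gt0 xs_r l_ge1 kappa_gt0 kappa_le1.
have meps : random_vector eps by case: eps_normal.
set t := Num.sqrt _.
have l_gt0 : 0 < l%:R :> R by rewrite ltr0n.
have q_gt0 : 0 < 2 * l%:R / kappa by rewrite divr_gt0// mulr_gt0.
(* The logarithm is positive because [kappa <= 1 < 2 * l]; the tail bound requires [t > 0]. *)
have ln_gt0 : 0 < ln (2 * l%:R / kappa).
  rewrite ln_gt0// ltr_pdivlMr// mul1r (le_lt_trans kappa_le1)//.
  have : 1 <= l%:R :> R by rewrite ler1n.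
  lra.
have t_gt0 : 0 < t by rewrite sqrtr_gt0 mulr_gt0.
pose F j := [set w | t * norm2 (xs j) <= `|dotv (xs j) (eps w)|].
have mF j : measurable (F j).
  rewrite -[X in measurable X]setTI; apply: measurable_fun_le => //.
  by apply: measurableT_comp => //; exact: measurable_dotv.
have mbad : measurable (\big[setU/set0]_(j < l) F j) by exact: bigsetU_measurable.
have PF j : (P (F j) <= (kappa / l%:R)%:E)%E.
  apply: (le_trans (gauss_tail_abs eps_normal _ t_gt0)); first by rewrite xs_r.
  rewrite lee_fin sqr_sqrtr; last by rewrite ltW// mulr_gt0.
  rewrite mulrAC divff// mul1r expRN lnK ?posrE//.
  by rewrite le_eqVlt; apply/orP; left; apply/eqP; field; rewrite !gt_eqF.
have Pbad : (P (\big[setU/set0]_(j < l) F j) <= kappa%:E)%E.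
  apply: (le_trans (measure_bigsetU_le _ _ mF)).
  apply: (le_trans (lee_sum _ (fun j _ => PF j))).
  rewrite sumEFin lee_fin sumr_const card_ord -[_ *+ _]mulr_natr divfK//.
  by rewrite gt_eqF.
apply: (@le_trans _ _ (P (~` (\big[setU/set0]_(j < l) F j)))).
  by rewrite probability_setC// EFinB leeD2l// leeN2.
apply: le_measure; rewrite ?inE.
- exact: measurableC.
- rewrite (_ : [set w | _] = \bigcap_(j in [set: 'I_l])
      [set w | `|dotv (xs j) (eps w)| <= r * t]).
    by apply: fin_bigcap_measurable => // j _; exact: measurable_dotv_abs_le.
  by apply/seteqP; split => w /= h j => [_|]; apply: h.
(* The bad events have non-strict inequalities, so a violation of the bound at [j] puts [w] in
   [F j]. *)
- move=> w /= nF j; rewrite leNgt; apply/negP => bad; apply: nF.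
  by rewrite (bigD1 j)//=; left; rewrite /F/= xs_r mulrC ltW.
Qed.

(** * Deterministic bounds: symmetric convex hulls and the Lasso *)

Lemma dotv_suml (R : realType) (n l : nat) (c : 'I_l -> R) (xs : 'I_l -> 'cV[R]_n)
    (v : 'cV[R]_n) :
  dotv (\sum_j c j *: xs j) v = \sum_j c j * dotv (xs j) v.
Proof.
rewrite /dotv; under [RHS]eq_bigr do rewrite mulr_sumr.
rewrite exchange_big/=; apply: eq_bigr => i _.
rewrite summxE mulr_suml; apply: eq_bigr => j _.
by rewrite mxE mulrA.
Qed.

(** By the triangle inequality, a combination with coefficients of total absolute value at most 1
    cannot exceed a bound common to all generators. This lets the [x_j] replace the columns of the
    design. *)
Lemma sconv_dotv_le (R : realType) (n l : nat) (xs : 'I_l -> 'cV[R]_n)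
    (u v : 'cV[R]_n) (b : R) :
  sconv xs u -> 0 <= b -> (forall j, `|dotv (xs j) v| <= b) -> `|dotv u v| <= b.
Proof.
move=> [c c1 ->] b_ge0 xsb; rewrite dotv_suml.
apply: (le_trans (ler_norm_sum _ _ _)).
apply: (@le_trans _ _ (\sum_j `|c j| * b)).
  by apply: ler_sum => j _; rewrite normrM ler_wpM2l.
by rewrite -mulr_suml -[leRHS]mul1r ler_wpM2r.
Qed.

(** Expanding the square in the comparison with [beta0] leaves the cross term
    [2 * dotv (X *m (b - beta0)) e]. Duality of the l1 and sup norms and the triangle inequality
    bound it by [lambda * (norm1 b + norm1 beta0)], and the terms in [norm1 b] cancel. *)
Lemma lasso_prediction_error (R : realType) (n p : nat) (X : 'M[R]_(n, p))
    (beta0 b : 'cV[R]_p) (e : 'cV[R]_n) (lambda : R) :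
  lasso X (X *m beta0 + e) lambda b ->
  (forall m, 2 * `|dotv (col m X) e| <= lambda) ->
  norm2 (X *m (b - beta0)) ^+ 2 <= 2 * lambda * norm1 beta0.
Proof.
move=> /(_ beta0); rewrite /lasso_criterion => basic noise.
have {basic} : norm2 (X *m (b - beta0)) ^+ 2 <=
    2 * dotv (X *m (b - beta0)) e + lambda * norm1 beta0 - lambda * norm1 b.
  move: basic; rewrite (addrC _ e) addrK -addrA -mulmxBr -opprB mulmxN.
  set D := X *m (b - beta0).
  have -> : norm2 (e - D) ^+ 2 = norm2 e ^+ 2 - 2 * dotv D e + norm2 D ^+ 2.
    rewrite -!dotvv /dotv mulr_sumr -sumrB -big_split/=.
    by apply: eq_bigr => i _; rewrite !mxE; ring.
  lra.
have XdE : dotv (X *m (b - beta0)) e = \sum_m (b - beta0) m 0 * dotv (col m X) e.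
  rewrite -dotv_suml; congr dotv; apply/matrixP => i k.
  rewrite ord1 mxE summxE; apply: eq_bigr => m _.
  by rewrite !mxE mulrC.
have : 2 * dotv (X *m (b - beta0)) e <= lambda * (norm1 b + norm1 beta0).
  rewrite XdE mulr_sumr /norm1 -big_split mulr_sumr; apply: ler_sum => m _.
  apply: (le_trans (ler_norm _)).
  rewrite mulrCA mulrC !normrM (ger0_norm (ler0n R 2)).
  apply: ler_pM => //.
  by rewrite !mxE ler_normB.
lra.
Qed.

(** * Control of the noise by the correlation factor *)

Lemma measurable_noise_le d (Omega : measurableType d) (R : realType) (n p : nat)
    (X : 'M[R]_(n, p)) (V : Omega -> 'cV[R]_n) (c : R) :
  random_vector V ->
  measurable [set w | forall m, `|dotv (col m X) (V w)| <= c].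
Proof.
move=> mV; rewrite (_ : [set w | _] = \bigcap_(m in [set: 'I_p])
    [set w | `|dotv (col m X) (V w)| <= c]).
  by apply: fin_bigcap_measurable => // m _; exact: measurable_dotv_abs_le.
by apply/seteqP; split => w /= h m => [_|]; apply: h.
Qed.

Lemma corr_fun_noise_bound (R : realType) (n p : nat) (X : 'M[R]_(n, p))
    (kappa x : R) d (Omega : measurableType d) (P : probability Omega R)
    (eps : Omega -> 'cV[R]_n) :
  (0 < n)%N -> (0 < p)%N -> (forall j, (X^T *m X) j j = n%:R) ->
  standard_normal_vector P eps -> 0 < kappa -> kappa <= 1 -> 0 <= x ->
  ((1 - kappa)%:E <=
   P [set w | forall m, `|dotv (col m X) (eps w)| <=
     (1 + x) * (Num.sqrt n%:R *
                Num.sqrt (2 * ln (2 * (corr_fun X x)%:R / kappa)))]%R)%E.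
Proof.
move=> n_gt0 p_gt0 XX eps_normal kappa_gt0 kappa_le1 x_ge0.
have meps : random_vector eps by case: eps_normal.
have [[l_ge1 [xs xs_sphere Xxs]] _] := corr_funP p_gt0 XX x_ge0.
have n0 : 0 < Num.sqrt n%:R :> R by rewrite sqrtr_gt0 ltr0n.
apply: (le_trans (gauss_max_abs_le eps_normal n0 xs_sphere l_ge1 kappa_gt0
  kappa_le1)).
apply: le_measure; rewrite ?inE.
(* The points [xs j] become the columns of a matrix, so that measurability for columns also serves
   for them. *)
- have := @measurable_noise_le _ _ _ _ _ (\matrix_(i, j) xs j i 0) _
    (Num.sqrt n%:R * Num.sqrt (2 * ln (2 * (corr_fun X x)%:R / kappa))) meps.
  congr measurable; apply/seteqP; split => w /= h j; have := h j.
    by congr (Num.norm (dotv _ _) <= _); apply/matrixP => i k; rewrite ord1 !mxE.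
  by congr (Num.norm (dotv _ _) <= _); apply/matrixP => i k; rewrite ord1 !mxE.
- exact: measurable_noise_le.
- move=> w /= h m; have [u su <-] := Xxs m.
  have -> : dotv ((1 + x) *: u) (eps w) = (1 + x) * dotv u (eps w).
    by rewrite /dotv mulr_sumr; apply: eq_bigr => i _; rewrite mxE mulrA.
  have x1_ge0 : 0 <= 1 + x by rewrite addr_ge0.
  rewrite normrM (ger0_norm x1_ge0) ler_wpM2l//.
  by apply: sconv_dotv_le h => //; rewrite mulr_ge0 ?sqrtr_ge0.
Qed.

(** Continuity from above: the events with slack [1/(k+1)] decrease to the event without slack, and
    a lower bound on their probabilities passes to the limit. *)
Lemma probability_le_limit d (Omega : measurableType d) (R : realType)
    (P : probability Omega R) (I : Type) (F : I -> Omega -> R) (a c : R) :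
  (forall c, measurable [set w | forall i, F i w <= c]) ->
  (forall e : R, (0 < e)%R -> a%:E <= P [set w | forall i, F i w <= c + e]%R)%E ->
  (a%:E <= P [set w | forall i, F i w <= c]%R)%E.
Proof.
move=> mF aP.
pose A k := [set w | forall i, F i w <= c + k.+1%:R^-1].
have AE : [set w | forall i, F i w <= c] = \bigcap_k A k.
  apply/seteqP; split => w /= h.
    by move=> k _ i; rewrite (le_trans (h i))// lerDl invr_ge0.
  move=> i; apply/ler_addgt0Pr => e e0.
  have [k ke] := @ltr_add_invr R 0 e e0.
  by rewrite (le_trans (h k Logic.I i))// lerD2l ltW// -[X in X < _]add0r.
rewrite AE.
have PA : P (A k) @[k --> \oo] --> P (\bigcap_k A k).
  apply: nonincreasing_cvg_mu => //.
  - by rewrite (le_lt_trans (probability_le1 _ _))// ?ltry//; exact: mF.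
  - by move=> k; exact: mF.
  - by rewrite -AE; exact: mF.
  - move=> k k' kk'; apply/subsetPset => w /= h i; rewrite (le_trans (h i))//.
    by rewrite lerD2l lef_pV2 ?posrE// ler_nat.
rewrite -(cvg_lim _ PA)//; apply: lime_ge; first exact: cvgP PA.
by apply: nearW => k; apply: aP; rewrite invr_gt0.
Qed.

(** The set of values contains the one at [x = 0] and is bounded below by 0, so [inf] is a true
    infimum, not a default value, and can be approached. *)
Lemma corr_factor_lt (R : realType) (n p : nat) (X : 'M[R]_(n, p))
    (kappa e : R) : 0 < e ->
  exists2 x, 0 <= x & (1 + x) * Num.sqrt (ln (2 * (corr_fun X x)%:R / kappa) /
    ln (2 * p%:R / kappa)) < corr_factor X kappa + e.
Proof.
move=> e_gt0; rewrite /corr_factor.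
set E := [set _ | _ in _].
have hE : has_inf E.
  split; first by eexists; exists 0 => //=.
  by exists 0 => _ [x /= x0 <-]; rewrite mulr_ge0 ?sqrtr_ge0// addr_ge0.
have [_ [x /= x0 <-] xlt] := inf_adherent e_gt0 hE.
by exists x.
Qed.

Theorem corollary3p1 (R : realType) (n p : nat) (X : 'M[R]_(n, p))
    (beta0 : 'cV[R]_p) (sigma kappa lambda : R)
    (d : measure_display) (Omega : measurableType d) (P : probability Omega R)
    (eps Y : Omega -> 'cV[R]_n) (betahat : Omega -> 'cV[R]_p)
    (n_ge1 : (1 <= n)%N) (p_ge1 : (1 <= p)%N)
    (X_normalized : forall j : 'I_p, (X^T *m X) j j = n%:R)
    (sigma_gt0 : 0 < sigma)
    (eps_normal : standard_normal_vector P eps)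
    (Y_model : forall w, Y w = X *m beta0 + sigma *: eps w)
    (kappa_gt0 : 0 < kappa) (kappa_le1 : kappa <= 1)
    (lambda_ge : corr_factor X kappa * 2 * sigma *
                   Num.sqrt (2 * n%:R * ln (2 * p%:R / kappa)) <= lambda)
    (betahat_measurable : random_vector betahat)
    (betahat_lasso : forall w, lasso X (Y w) lambda (betahat w)) :
  ((1 - kappa)%:E <=
     P [set w | norm2 (X *m (betahat w - beta0)) ^+ 2
                  <= 2 * lambda * norm1 beta0]%R)%E.
Proof.
have meps : random_vector eps by case: eps_normal.
(* Scaled so that [N m w <= lambda] for all [m] is the noise condition of the Lasso bound with noise
   [sigma *: eps w]. *)
pose N m w := 2 * sigma * `|dotv (col m X) (eps w)|.
have s2_gt0 : 0 < 2 * sigma by rewrite mulr_gt0.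
have NE c : [set w | forall m, N m w <= c] =
    [set w | forall m, `|dotv (col m X) (eps w)| <= c / (2 * sigma)].
  by apply/seteqP; split => w /= h m; have := h m; rewrite /N ler_pdivlMr// mulrC.
have mN c : measurable [set w | forall m, N m w <= c].
  by rewrite NE; exact: measurable_noise_le.
have PN : ((1 - kappa)%:E <= P [set w | forall m, N m w <= lambda]%R)%E.
  apply: probability_le_limit => // e e_gt0.
  set L := ln (2 * p%:R / kappa) in lambda_ge.
  have L_gt0 : 0 < L.
    rewrite ln_gt0// ltr_pdivlMr// mul1r (le_lt_trans kappa_le1)//.
    have : 1 <= p%:R :> R by rewrite ler1n.
    lra.
  have n_gt0 : 0 < n%:R :> R by rewrite ltr0n.
  (* The lower bound on [lambda] is [corr_factor X kappa * q], so slack [e / q] in the correlation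
     factor becomes slack [e] in [lambda]. *)
  pose q := 2 * sigma * Num.sqrt (2 * n%:R * L).
  have q_gt0 : 0 < q by rewrite mulr_gt0// sqrtr_gt0 !mulr_gt0.
  have [x x_ge0 xlt] := @corr_factor_lt _ _ _ X kappa _ (divr_gt0 e_gt0 q_gt0).
  apply: (le_trans (corr_fun_noise_bound n_ge1 p_ge1 X_normalized eps_normal
    kappa_gt0 kappa_le1 x_ge0)).
  apply: le_measure; rewrite ?inE//; first exact: measurable_noise_le.
  move=> w /= h m; apply: (@le_trans _ _ (q * ((1 + x) *
    Num.sqrt (ln (2 * (corr_fun X x)%:R / kappa) / L)))); last first.
    rewrite (le_trans (ltW (_ : _ < q * (corr_factor X kappa + e / q))))//.
      by rewrite ltr_pM2l.
    rewrite mulrDr mulrCA divff ?gt_eqF// mulr1 lerD2r (le_trans _ lambda_ge)//.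
    by rewrite /q le_eqVlt; apply/orP; left; apply/eqP; ring.
  rewrite /N /q -[leRHS]mulrA ler_pM2l// (le_trans (h m))// [leRHS]mulrCA.
  rewrite ler_wpM2l ?addr_ge0//.
  (* Under the square roots, the factor [L] of [q] cancels the denominator [L] in the correlation
     factor. *)
  rewrite -!sqrtrM ?mulr_ge0 ?(ltW L_gt0)//.
  rewrite le_eqVlt; apply/orP; left; apply/eqP; congr Num.sqrt.
  by field; rewrite gt_eqF.
apply: (le_trans PN); apply: le_measure; rewrite ?inE.
- exact: mN.
- rewrite -[X in measurable X]setTI; apply: measurable_fun_le => //.
  (* The squared prediction error is a polynomial in the coordinates of [betahat w], hence
     measurable. *)
  rewrite (_ : (fun _ => _) = fun w => \sum_(i < n)
      (\sum_(m < p) X i m * (betahat w m 0 - beta0 m 0)) ^+ 2).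
    apply: measurable_sum => i; apply: measurable_funX.
    apply: measurable_sum => m; apply: measurable_funM => //.
    by apply: measurable_funB.
  apply/funext => w; rewrite -dotvv; apply: eq_bigr => i _.
  by rewrite !mxE -expr2; congr (_ ^+ 2); apply: eq_bigr => m _; rewrite !mxE.
- move=> w /= h; apply: (@lasso_prediction_error _ _ _ _ _ _ (sigma *: eps w)).
    by rewrite -Y_model.
  move=> m; rewrite (le_trans _ (h m))// /N.
  have -> : dotv (col m X) (sigma *: eps w) = sigma * dotv (col m X) (eps w).
    by rewrite /dotv mulr_sumr; apply: eq_bigr => i _; rewrite !mxE mulrCA.
  by rewrite normrM gtr0_norm// mulrA.
Qed.
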